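(* Let $\pi_{\rm loc}$ be a probability density on $(0,\infty)$ and, for $\tau>0$ and $\beta_j^*\neq0$, let $\lambda_j\mid\beta_j^*,\tau$ have density $\pi(\lambda_j\mid\beta_j^*,\tau)\propto\lambda_j^{-1}\exp\!\big(-\beta_j^{*2}/(2\tau^2\lambda_j^2)\big)\pi_{\rm loc}(\lambda_j)$ on $(0,\infty)$. Then: For any $a>0$, the tail probability $\mathbb P(\lambda_j\ge a\mid\beta_j^*,\tau)$ is an increasing (i.e. nondecreasing) function of $|\beta_j^*/\tau|$. If $\int_0^\infty\lambda^{-1}\pi_{\rm loc}(\lambda)\,d\lambda=\infty$, then as $|\beta_j^*/\tau|\to0$ this tail probability converges to $0$ for every $a>0$, i.e. the conditional $\lambda_j\mid\beta_j^*,\tau$ converges in distribution to the delta measure at $0$. If $\int_0^\infty\lambda^{-1}\pi_{\rm loc}(\lambda)\,d\lambda<\infty$, then the conditional $\lambda_j\mid\beta_j^*,\tau$ converges in distribution to the law with density $\pi(\lambda_j)\propto\lambda_j^{-1}\pi_{\rm loc}(\lambda_j)$ as $|\beta_j^*/\tau|\to0$.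
   Context: The density $\pi(\lambda_j\mid\beta_j^*,\tau)$ is the conditional of the local scale under the global-local prior $\beta_j\mid\tau,\lambda_j\sim\mathcal N(0,\tau^2\lambda_j^2)$, $\lambda_j\sim\pi_{\rm loc}$; it depends on $(\beta_j^*,\tau)$ only through $|\beta_j^*/\tau|$. *)

(* Defs.v *)
From HB Require Import structures.
From mathcomp Require Import all_boot all_order all_algebra.
From mathcomp Require Import all_classical all_reals all_analysis.
From mathcomp Require Import measurable_realfun ring lra.
Set Implicit Arguments.
Unset Strict Implicit.
Unset Printing Implicit Defensive.
Import Order.TTheory GRing.Theory Num.Theory.
Import numFieldNormedType.Exports.
Local Open Scope classical_set_scope.
Local Open Scope ring_scope.

Record pos_weight (R : realType) := PosWeight {
  weight :> R -> R ;
  measurable_weight : measurable_fun (`]0, +oo[ : set R) weight ;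
  weight_ge0 : forall x : R, 0 < x -> 0 <= weight x }.

Record pos_pdf (R : realType) := PosPdf {
  pdf :> R -> R ;
  measurable_pdf : measurable_fun (`]0, +oo[ : set R) pdf ;
  pdf_ge0 : forall x : R, 0 < x -> 0 <= pdf x ;
  integral_pdf : (\int[lebesgue_measure]_(x in `]0%R, +oo[) (pdf x)%:E = 1)%E }.

(* The laws live on R, so that they can be compared with the point mass at 0;
   they give no mass to the complement of ]0, +oo[. *)
Definition weight_measure (R : realType) (w : pos_weight R)
    (A : set (measurableTypeR R)) : \bar R :=
  (\int[lebesgue_measure]_(x in A `&` `]0%R, +oo[) (w x)%:E)%E.

Section weight_measure.
Context {R : realType} (w : pos_weight R).
Local Open Scope ereal_scope.

Let weight_measure0 : weight_measure w set0 = 0.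
Proof. by rewrite /weight_measure set0I integral_set0. Qed.

Let weight_measure_ge0 A : 0 <= weight_measure w A.
Proof.
apply: integral_ge0 => x [_]; rewrite /= in_itv/= andbT => x0.
by rewrite lee_fin weight_ge0.
Qed.

Let weight_measure_sigma_additive : semi_sigma_additive (weight_measure w).
Proof.
move=> F mF tF mUF; rewrite /weight_measure setI_bigcupl.
rewrite ge0_integral_bigcup//=.
- apply: is_cvg_ereal_nneg_natsum_cond => n _ _.
  exact: (weight_measure_ge0 (F n)).
- by move=> k; apply: measurableI => //; exact: mF.
- apply/measurable_EFinP.
  rewrite -setI_bigcupl; apply: measurable_funS (measurable_weight w) => //.
- move=> x [k _ [_]]; rewrite /= in_itv/= andbT => x0.
  by rewrite lee_fin weight_ge0.
- exact: trivIset_setIr.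
Qed.

HB.instance Definition _ := isMeasure.Build _ _ _ (weight_measure w)
  weight_measure0 weight_measure_ge0 weight_measure_sigma_additive.

End weight_measure.

(* The law with density proportional to w on ]0, +oo[; the second argument of
   mnormalize is only used when w has mass 0 or +oo, and then is arbitrary. *)
Definition law_propto (R : realType) (w : pos_weight R) :
    probability (measurableTypeR R) R :=
  mnormalize (weight_measure w) (dirac (1 : measurableTypeR R)).

Section weights.
Context {R : realType} (p : pos_pdf R).

Let measurable_inv : measurable_fun (`]0, +oo[ : set R) (@GRing.inv R).
Proof.
apply: open_continuous_measurable_fun; first exact: interval_open.
move=> x; rewrite inE/= in_itv/= andbT => x0.
by apply: inv_continuous; rewrite gt_eqF.
Qed.

Let measurable_inv_pdf :
  measurable_fun (`]0, +oo[ : set R) (fun x => x^-1 * p x).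
Proof.
by apply: measurable_funM => //; exact: measurable_pdf.
Qed.

Let inv_pdf_ge0 (x : R) : 0 < x -> 0 <= x^-1 * p x.
Proof. by move=> x0; rewrite mulr_ge0 ?pdf_ge0 ?invr_ge0 ?ltW. Qed.

Definition inv_weight : pos_weight R :=
  PosWeight measurable_inv_pdf inv_pdf_ge0.

(* The density at beta of N(0, tau^2 x^2), times the prior density p x, up to a
   factor independent of x. *)
Definition local_kernel (beta tau x : R) : R :=
  x^-1 * expR (- (beta ^+ 2 / (2 * tau ^+ 2 * x ^+ 2))) * p x.

Let measurable_local_kernel beta tau :
  measurable_fun (`]0, +oo[ : set R) (local_kernel beta tau).
Proof.
apply: measurable_funM; last exact: measurable_pdf.
apply: measurable_funM => //.
rewrite (_ : (fun x => _) =
    fun x : R => expR (- (beta ^+ 2 / (2 * tau ^+ 2)) * x^-1 ^+ 2)); last first.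
  by apply/funext => x; rewrite mulNr exprVn invfM mulrA.
apply: measurableT_comp => //.
by apply: measurable_funM => //; exact: measurable_funX.
Qed.

Let local_kernel_ge0 beta tau (x : R) : 0 < x -> 0 <= local_kernel beta tau x.
Proof.
by move=> x0; rewrite !mulr_ge0 ?expR_ge0 ?pdf_ge0 ?invr_ge0 ?ltW.
Qed.

Definition local_weight beta tau : pos_weight R :=
  PosWeight (measurable_local_kernel beta tau)
            (@local_kernel_ge0 beta tau).

Definition local_law (beta tau : R) : probability (measurableTypeR R) R :=
  law_propto (local_weight beta tau).

End weights.

Lemma mulr_expRN_le (R : realType) (c x : R) : 0 < c -> 0 < x ->
  x^-1 * expR (- (c / x ^+ 2)) <= 1 + c^-1.
Proof.
move=> c0 x0; rewrite expRN ler_pdivrMr ?expR_gt0//.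
set u := x^-1; have u0 : 0 < u by rewrite invr_gt0.
have -> : c / x ^+ 2 = c * u ^+ 2 by rewrite exprVn.
apply: (@le_trans _ _ ((1 + c^-1) * (1 + c * u ^+ 2))); last first.
  by rewrite ler_wpM2l ?expR_ge1Dx// addr_ge0// invr_ge0 ltW.
have ci0 : 0 < c^-1 by rewrite invr_gt0.
have -> : (1 + c^-1) * (1 + c * u ^+ 2) = 1 + c * u ^+ 2 + c^-1 + u ^+ 2.
  by field; rewrite gt_eqF.
have : u <= 1 + u ^+ 2.
  have := sqr_ge0 (u - 1); rewrite sqrrB1 => h.
  have : 2 * u <= 1 + u ^+ 2 by rewrite -subr_ge0; lra.
  by lra.
have : 0 <= c * u ^+ 2 by rewrite mulr_ge0 ?sqr_ge0// ltW.
by lra.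
Qed.

(* For beta != 0 and 0 < tau the kernel has positive finite mass, so that
   mnormalize really normalizes it. *)
Lemma local_weight_mass (R : realType) (p : pos_pdf R) (beta tau : R) :
  beta != 0 -> 0 < tau ->
  (0 < weight_measure (local_weight p beta tau) setT < +oo)%E.
Proof.
move=> b0 t0; rewrite /weight_measure setTI.
have c0 : 0 < beta ^+ 2 / (2 * tau ^+ 2).
  by rewrite divr_gt0 ?exprn_even_gt0// mulr_gt0// exprn_gt0.
set D : set (measurableTypeR R) := `]0, +oo[%classic.
have mD : measurable D by exact: measurable_itv.
have mp : measurable_fun D (EFin \o p).
  by apply/measurable_EFinP; exact: measurable_pdf.
have mw : measurable_fun D (EFin \o local_weight p beta tau).
  by apply/measurable_EFinP; exact: measurable_weight.
have D0 x : D x -> 0 < x by rewrite /D/= in_itv/= andbT.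
apply/andP; split.
  rewrite lt_neqAle integral_ge0 ?andbT; last first.
    by move=> x /D0 x0; rewrite lee_fin weight_ge0.
  apply/eqP => /esym w0.
  have : (\int[lebesgue_measure]_(x in D)
      `|(EFin \o local_weight p beta tau) x| = 0)%E.
    rewrite -[RHS]w0; apply: eq_integral => x /set_mem /D0 x0.
    by rewrite gee0_abs// lee_fin weight_ge0.
  move/(ae_eq_integral_abs lebesgue_measure mD mw) => wae.
  have : ae_eq lebesgue_measure D (EFin \o p) (cst 0%E).
    apply: filterS wae => x h Dx; have x0 := D0 _ Dx.
    have /eqP := h Dx; rewrite /= eqe /local_kernel !mulf_eq0 invr_eq0.
    by rewrite (gt_eqF x0) gt_eqF ?expR_gt0//= => /eqP ->.
  move=> pae; have := integral_pdf p.
  rewrite [LHS](ae_eq_integral (cst 0%E) _ mD mp _ pae)//.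
  by rewrite integral0 => /eqP; rewrite eq_sym onee_eq0.
apply: (@le_lt_trans _ _ (\int[lebesgue_measure]_(x in D)
    ((1 + (beta ^+ 2 / (2 * tau ^+ 2))^-1)%:E * (p x)%:E))%E); last first.
  rewrite ge0_integralZl_EFin//; first by rewrite integral_pdf mule1 ltry.
  - by move=> x /D0 x0; rewrite lee_fin pdf_ge0.
  - by rewrite addr_ge0// invr_ge0 ltW.
apply: ge0_le_integral => //.
- by move=> x /D0 x0; rewrite lee_fin weight_ge0.
- by apply: measurable_funeM.
- move=> x /D0 x0; rewrite -EFinM lee_fin /= /local_kernel.
  rewrite ler_wpM2r ?pdf_ge0//.
  by rewrite [in leLHS]invfM mulrA mulr_expRN_le.
Qed.

Lemma local_lawE (R : realType) (p : pos_pdf R) (beta tau : R)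
    (A : set (measurableTypeR R)) : beta != 0 -> 0 < tau ->
  local_law p beta tau A =
  ((\int[lebesgue_measure]_(x in A `&` `]0%R, +oo[) (local_kernel p beta tau x)%:E)
   * (fine (\int[lebesgue_measure]_(x in `]0%R, +oo[)
        (local_kernel p beta tau x)%:E))^-1%:E)%E.
Proof.
move=> b0 t0; have /andP[m0 moo] := local_weight_mass p b0 t0.
rewrite /local_law /law_propto /= /mnormalize /= gt_eqF// lt_eqF//=.
by rewrite /weight_measure setTI.
Qed.

(* [|beta / tau| --> 0] for pairs (beta, tau) with beta != 0 and 0 < tau. *)
Definition ratio_to0 (R : realType) : set_system (R * R) :=
  filter_from [set e : R | 0 < e]
    (fun e => [set bt | [/\ bt.1 != 0, 0 < bt.2 & `|bt.1 / bt.2| < e]]).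

Instance ratio_to0_filter (R : realType) : ProperFilter (@ratio_to0 R).
Proof.
apply: filter_from_proper; first apply: filter_from_filter.
- by exists 1; exact: ltr01.
- move=> i j i0 j0; exists (Num.min i j); first by rewrite /= lt_min i0.
  by move=> bt [b0 t0]; rewrite lt_min => /andP[? ?]; split; split.
- move=> e /= e0; exists (e / 2, 1) => /=.
  by split; rewrite ?gt_eqF ?divr_gt0// divr1 gtr0_norm ?divr_gt0//; lra.
Qed.

(* Weak convergence, tested against bounded continuous functions. *)
Definition cvg_in_distribution (R : realType) (T : Type) (F : set_system T)
    (P : T -> probability (measurableTypeR R) R)
    (Q : probability (measurableTypeR R) R) : Prop :=
  forall f : R -> R, continuous f -> bounded_fun f ->
    (\int[P t]_x (f x)%:E)%E @[t --> F] --> (\int[Q]_x (f x)%:E)%E.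

(* Main.v *)
Require Import Defs.
From mathcomp Require Import all_boot all_order all_algebra.
From mathcomp Require Import all_classical all_reals all_analysis.
From mathcomp Require Import measurable_realfun lra.
Import Order.TTheory GRing.Theory Num.Theory.
Import numFieldNormedType.Exports.
Local Open Scope classical_set_scope.
Local Open Scope ring_scope.

(* The kernel depends on [(beta, tau)] only through [s = |beta / tau|], and
   passing from [s] to [u >= s] multiplies it by [exp (- (u^2 - s^2) / (2 x^2))],
   which increases with [x]: tails gain mass relative to their complement.
   As [s] decreases to 0 the kernel increases to [x^-1 * pi_loc x], so by monotone
   convergence its mass [M s] tends to [M 0].  If [M 0] is infinite, the tail
   masses, bounded by [1 / a], vanish after normalization.  If it is finite, the
   normalized law at [s] is dominated by [M 0 / M s] times the limit law; a
   domination between probabilities by a factor tending to 1 forces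
   convergence in distribution. *)

(** * Bounded functions integrated against a probability *)

Lemma bounded_funE (R : realType) (T : Type) (f : T -> R) : bounded_fun f ->
  exists2 K, 0 <= K & forall x, `|f x| <= K.
Proof.
(* [bounded_fun] bounds [f] by every number strictly above [M], and [M] may be negative; hence
   [|M| + 1]. *)
move=> [M [_ fM]]; exists (`|M| + 1); first by rewrite addr_ge0.
by move=> x; apply: fM => //; rewrite ltr_pwDr// ler_norm.
Qed.

Section bounded_under_probability.
Context {R : realType} (P : probability (measurableTypeR R) R).

Lemma bounded_integrable (f : R -> R) : measurable_fun setT f ->
  bounded_fun f -> P.-integrable setT (EFin \o f).
Proof.
move=> mf bf; apply: measurable_bounded_integrable => //.
by rewrite [X in (X < _)%E]probability_setT ltry.
Qed.

Lemma integral_EFinE (f : R -> R) : P.-integrable setT (EFin \o f) ->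
  (\int[P]_x (f x)%:E)%E = (\int[P]_x f x)%:E.
Proof. by move=> Pf; rewrite fineK//; exact: integrable_fin_num. Qed.

Lemma Rintegral_probability_cst (k : R) : \int[P]_x k = k.
Proof.
by rewrite Rintegral_cst// [X in fine X]probability_setT mulr1.
Qed.

Lemma integrable_cst_probability (k : R) : P.-integrable setT (EFin \o cst k).
Proof. exact: finite_measure_integrable_cst. Qed.

End bounded_under_probability.

(** * Two criteria for convergence in distribution *)

Section convergence_in_distribution.
Context {R : realType} {T : Type} {F : set_system T} {FF : Filter F}.
Variable P : T -> probability (measurableTypeR R) R.

(** The integral of [|f - f x0|] is split at distance [a] from [x0]: inside, continuity makes the
    integrand small; outside, it is at most [2 * K], and the mass there vanishes. *)
Lemma cvg_in_distribution_dirac (x0 : R) :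
  (forall a, 0 < a -> P t [set x | a <= `|x - x0|] @[t --> F] --> 0%E) ->
  cvg_in_distribution F P (dirac (x0 : measurableTypeR R)).
Proof.
move=> P0 f cf bf.
have mf : measurable_fun setT f by exact: continuous_measurable_fun.
have fi t : (P t).-integrable setT (EFin \o f) by exact: bounded_integrable.
rewrite integral_dirac//; last exact/measurable_EFinP.
rewrite diracT mul1e.
under eq_fun do rewrite integral_EFinE//.
apply: cvg_EFin; first by near=> t.
have [K K0 fK] := @bounded_funE _ _ _ bf.
apply/cvgrPdist_le => e e0 /=.
have e20 : 0 < e / 2 by rewrite divr_gt0.
have [a/= a0 fa] : exists2 a : R, 0 < a &
    forall x, `|x - x0| < a -> `|f x - f x0| <= e / 2.
  have /cvgrPdist_le/(_ _ e20)/nbhs_ballP[a a0 h] := cf x0.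
  by exists a => // x xa; rewrite distrC; apply: h; rewrite /ball/= distrC.
pose B : set (measurableTypeR R) := [set x | a <= `|x - x0|].
have mB : measurable B.
  rewrite /B (_ : [set _ | _] = (fun x : R => `|x - x0|) @^-1` `[a, +oo[).
    rewrite -[X in measurable X]setTI.
    have : measurable_fun [set: measurableTypeR R] (fun x : R => `|x - x0|).
      by apply: measurableT_comp => //; apply: measurable_funB.
    by apply => //; exact: measurable_itv.
  by apply/seteqP; split => x /=; rewrite in_itv/= andbT.
(* The [+ 1] keeps the denominator positive when [K = 0]; a mass of [B] below this threshold
   contributes at most [e / 2]. *)
have KK : 0 < e / 2 / (2 * K + 1) by rewrite divr_gt0//; lra.
have /fine_cvgP[_ /cvgrPdist_le /(_ _ KK) PB] := P0 _ a0.
near=> t.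
have PBt : fine (P t B) <= e / 2 / (2 * K + 1).
  have : `|0 - fine (P t B)| <= e / 2 / (2 * K + 1) by near: t.
  by rewrite sub0r normrN; apply: le_trans; rewrite ler_norm.
have iB : (P t).-integrable setT (EFin \o \1_B) by exact: integrable_indic.
have i2 : (P t).-integrable setT (EFin \o (fun x => 2 * K * \1_B x)).
  by have := integrableZl measurableT (2 * K) iB.
have ifx : (P t).-integrable setT (EFin \o (fun x => f x - f x0)).
  have := integrable_cst_probability (P t) (f x0).
  by move=> /(integrableB measurableT (fi t)).
(* Since [P t] has mass 1, the constant [f x0] is its own integral, and the distance becomes the
   integral of one difference. *)
rewrite distrC -[X in _ - X](Rintegral_probability_cst (P t)).
rewrite -RintegralB//; last 2 first.
- exact: fi.
- exact: integrable_cst_probability.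
apply: (le_trans (le_normr_Rintegral _ _)) => //.
apply: (@le_trans _ _ (\int[P t]_x (e / 2 + 2 * K * \1_B x))).
  apply: le_Rintegral => //.
  - by have := integrable_abse ifx.
  - have := integrable_cst_probability (P t) (e / 2).
    by move=> /(integrableD measurableT)/(_ i2).
  - move=> x _; rewrite indicE; case: (boolP (x \in B)) => [_|].
      rewrite mulr1; have := ler_normB (f x) (f x0).
      by have := fK x; have := fK x0; lra.
    rewrite mulr0 addr0 notin_setE /B/= => /negP; rewrite -ltNge.
    exact: fa.
rewrite RintegralD//; last exact: integrable_cst_probability.
rewrite Rintegral_probability_cst RintegralZl//.
have -> : \int[P t]_x (\1_B x) = fine (P t B).
  by rewrite /Rintegral integral_indic// setIT.
have : 2 * K * fine (P t B) <= e / 2.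
  have h : 0 < 2 * K + 1 by lra.
  move: PBt; rewrite ler_pdivlMr// => PBt.
  have : 0 <= fine (P t B) by rewrite fine_ge0.
  by nra.
by lra.
Unshelve. all: by end_near. Qed.

(* Applying the domination to [K + f] and [K - f], which are nonnegative when
   [`|f| <= K], bounds the integral of [f] from both sides. *)
Lemma cvg_in_distribution_dominated (r : T -> R)
    (Q : probability (measurableTypeR R) R) :
  r @ F --> (1 : R) ->
  (\forall t \near F, forall A, measurable A -> (P t A <= (r t)%:E * Q A)%E) ->
  cvg_in_distribution F P Q.
Proof.
move=> r1 PQ f cf bf.
have mf : measurable_fun setT f by exact: continuous_measurable_fun.
have fi (p : probability (measurableTypeR R) R) :
  p.-integrable setT (EFin \o f) by exact: bounded_integrable.
under eq_fun do rewrite integral_EFinE//.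
rewrite integral_EFinE//.
apply: cvg_EFin; first by near=> t.
have [K K0 fK] := @bounded_funE _ _ _ bf.
(* Comparing the integrals of [g + K] and moving [K] to the right leaves the error [(r t - 1) * K],
   which tends to 0. A general [g] allows both [f] and [- f]. *)
have dom (g : R -> R) : measurable_fun setT g -> (forall x, `|g x| <= K) ->
    \forall t \near F, \int[P t]_x g x <= r t * (\int[Q]_x g x) + (r t - 1) * K.
  move=> mg gK; near=> t.
  (* Nonnegativity, which holds eventually because [r] tends to 1, makes [r t] times [Q] a
     measure. *)
  have rt0 : 0 <= r t.
    near: t; have /cvgrPdist_lt/(_ _ ltr01) := r1.
    by apply: filterS => t; rewrite ltr_norml; lra.
  have PQt A : measurable A -> (P t A <= (r t)%:E * Q A)%E.
    by move: A; near: t.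
  have gi (p : probability (measurableTypeR R) R) :
      p.-integrable setT (EFin \o g).
    apply: bounded_integrable => //; exists K; split; first exact: num_real.
    by move=> x Kx y _ /=; exact: le_trans (gK y) (ltW Kx).
  have gKi (p : probability (measurableTypeR R) R) :
      p.-integrable setT (EFin \o (fun x => g x + K)).
    by have := integrableD measurableT (gi p) (integrable_cst_probability p K).
  have gK0 x : (0 <= (g x + K)%:E)%E.
    by rewrite lee_fin; have := gK x; rewrite ler_norml; lra.
  have mgK : measurable_fun [set: measurableTypeR R] (fun x => (g x + K)%:E).
    by apply/measurable_EFinP; apply: measurable_funD.
  have : (\int[P t]_x (g x + K)%:E <=
      \int[mscale (NngNum rt0) Q]_x (g x + K)%:E)%E.
    exact: ge0_le_measure_integral.
  rewrite ge0_integral_mscale//= !integral_EFinE// -EFinM lee_fin.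
  rewrite !RintegralD//; [|exact: gi|exact: integrable_cst_probability
    |exact: gi|exact: integrable_cst_probability].
  by rewrite !Rintegral_probability_cst; lra.
have lim (k : R) : r t * (\int[Q]_x f x) + (r t - 1) * k @[t --> F] -->
    \int[Q]_x f x.
  rewrite -[X in _ --> X]addr0 -[X in X + 0]mul1r -[X in _ + X](mul0r k).
  apply: cvgD; first by apply: cvgM => //; exact: cvg_cst.
  apply: cvgM; last exact: cvg_cst.
  by rewrite -(subrr 1); apply: cvgB => //; exact: cvg_cst.
have RintN (p : probability (measurableTypeR R) R) :
    \int[p]_x (- f x) = - \int[p]_x f x.
  rewrite -[RHS]mulN1r -RintegralZl//; last exact: fi.
  by apply: eq_Rintegral => x _; rewrite mulN1r.
have mNf : measurable_fun setT (fun x => - f x) by exact: measurableT_comp.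
have NfK x : `|- f x| <= K by rewrite normrN.
have lower := dom _ mNf NfK; have upper := dom f mf fK.
have sandwich : \forall t \near F,
    r t * (\int[Q]_x f x) + (r t - 1) * (- K) <= \int[P t]_x f x
      <= r t * (\int[Q]_x f x) + (r t - 1) * K.
  apply: filterS2 lower upper => t; rewrite !RintN /= => lower upper.
  by apply/andP; split => //; lra.
exact: squeeze_cvgr sandwich _ (lim (- K)) (lim K).
Unshelve. all: by end_near. Qed.

End convergence_in_distribution.

(** * Comparison of measures given by weights, before and after normalization *)

Section weight_measure_theory.
Context {R : realType}.
Implicit Types (w : pos_weight R) (A B : set (measurableTypeR R)).

Lemma le_weight_measure w1 w2 (q : R) A : measurable A -> 0 <= q ->
  (forall x, A x -> 0 < x -> w1 x <= q * w2 x) ->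
  (weight_measure w1 A <= q%:E * weight_measure w2 A)%E.
Proof.
move=> mA q0 w12; rewrite /weight_measure.
have mD : measurable (A `&` `]0, +oo[ : set (measurableTypeR R)).
  by apply: measurableI => //; exact: measurable_itv.
have mw w : measurable_fun (A `&` `]0, +oo[ : set (measurableTypeR R))
    (EFin \o w).
  by apply/measurable_EFinP; apply: measurable_funS (measurable_weight w).
have D0 x : (A `&` `]0, +oo[) x -> 0 < x by move=> [_]; rewrite /= in_itv/= andbT.
rewrite -ge0_integralZl_EFin//; last 2 first.
- by move=> x /D0 x0; rewrite lee_fin weight_ge0.
- exact: mw.
apply: ge0_le_integral => //.
- by move=> x /D0 x0; rewrite lee_fin weight_ge0.
- exact: mw.
- by apply: measurable_funeM; exact: mw.
- by move=> x Dx; rewrite -EFinM lee_fin w12//; [case: Dx|exact: D0].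
Qed.

Lemma law_proptoE w A : (0 < weight_measure w setT < +oo)%E ->
  law_propto w A =
  (weight_measure w A * (fine (weight_measure w setT))^-1%:E)%E.
Proof.
by case/andP=> m0 moo; rewrite /law_propto /= /mnormalize /= gt_eqF// lt_eqF.
Qed.

Lemma weight_measure_fin_num w A : measurable A ->
  (weight_measure w setT < +oo)%E -> weight_measure w A \is a fin_num.
Proof.
move=> mA moo; rewrite ge0_fin_numE; last exact: measure_ge0.
by apply: le_lt_trans moo; apply: le_measure; rewrite ?inE.
Qed.

(* With [S] and [T] the masses of [~` B] and [B], the claim is
   [T1 * S2 <= T2 * S1], and both sides are separated by [q * T1 * S1]. *)
Lemma law_propto_le_ratio w1 w2 (q : R) B : measurable B -> 0 < q ->
  (0 < weight_measure w1 setT < +oo)%E ->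
  (0 < weight_measure w2 setT < +oo)%E ->
  (forall x, B x -> 0 < x -> q * w1 x <= w2 x) ->
  (forall x, ~ B x -> 0 < x -> w2 x <= q * w1 x) ->
  (law_propto w1 B <= law_propto w2 B)%E.
Proof.
move=> mB q0 m1 m2 wB wNB; rewrite !law_proptoE//.
have mNB := measurableC mB.
have split w : (weight_measure w setT < +oo)%E ->
    exists S T : R, [/\ 0 <= S, 0 <= T, weight_measure w (~` B) = S%:E,
      weight_measure w B = T%:E & weight_measure w setT = (S + T)%:E].
  move=> moo; exists (fine (weight_measure w (~` B))).
  exists (fine (weight_measure w B)).
  have fB := weight_measure_fin_num w _ mB moo.
  have fNB := weight_measure_fin_num w _ mNB moo.
  split; rewrite ?fine_ge0 ?fineK//; try exact: measure_ge0.
  rewrite EFinD !fineK//.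
  have := measureDI (weight_measure w) measurableT mB.
  by rewrite setTD setTI => ->.
move: m1 m2 => /andP[m1 m1oo] /andP[m2 m2oo].
have T12 : (weight_measure w1 B <= q^-1%:E * weight_measure w2 B)%E.
  apply: le_weight_measure => //; first by rewrite invr_ge0 ltW.
  by move=> x Bx x0; rewrite ler_pdivlMl ?wB.
have S21 : (weight_measure w2 (~` B) <= q%:E * weight_measure w1 (~` B))%E.
  by apply: le_weight_measure => //; exact: ltW.
have [S1 [T1 [S10 T10 w1NB w1B w1T]]] := split w1 m1oo.
have [S2 [T2 [S20 T20 w2NB w2B w2T]]] := split w2 m2oo.
move: m1 m2 T12 S21; rewrite w1T w2T w1B w2B w1NB w2NB /=.
rewrite -!EFinM !lee_fin !lte_fin ler_pdivlMl// => m1 m2 T12 S21.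
(* Cross-multiplying the two normalizations puts [T1 * T2] on both sides, where it cancels. *)
rewrite ler_pdivrMr// mulrAC ler_pdivlMr// !mulrDr (mulrC T2 T1) lerD2r.
apply: (@le_trans _ _ (q * T1 * S1)); last by rewrite ler_wpM2r.
by rewrite mulrAC [leRHS]mulrC ler_wpM2l.
Qed.

End weight_measure_theory.

(** * The kernel as a function of the ratio, and monotonicity of the tails *)

Section local_law_theory.
Context {R : realType} (p : pos_pdf R).

(** Fixing the global scale at 1 makes the ratio equal to [s] for [s >= 0], so the normalizing
    constant becomes a function of one real variable. *)
Definition local_mass (s : R) : \bar R :=
  weight_measure (local_weight p s 1) setT.

Lemma local_kernelE (b t x : R) : local_kernel p b t x =
  x^-1 * expR (- (`|b / t| ^+ 2 / 2 / x ^+ 2)) * p x.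
Proof.
rewrite /local_kernel real_normK ?num_real// exprMn exprVn.
congr (_ * expR (- _) * _).
by rewrite (invfM _ (x ^+ 2)) (invfM 2) !mulrA (mulrAC (b ^+ 2)).
Qed.

Lemma local_kernel_ratio (b t x : R) :
  local_kernel p b t x = local_kernel p `|b / t| 1 x.
Proof. by rewrite !local_kernelE divr1 normr_id. Qed.

Lemma weight_measure_ratio (b t : R) :
  weight_measure (local_weight p b t) =
  weight_measure (local_weight p `|b / t| 1).
Proof.
by apply/funext => A; apply: eq_integral => x _; rewrite /= local_kernel_ratio.
Qed.

Lemma local_kernel_expR (s u x : R) : local_kernel p u 1 x =
  expR (- ((u ^+ 2 - s ^+ 2) / 2 / x ^+ 2)) * local_kernel p s 1 x.
Proof.
rewrite !local_kernelE !divr1 !real_normK ?num_real//.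
rewrite mulrA (mulrC (expR _)) -[in RHS](mulrA x^-1) -expRD.
by congr (_ * expR _ * _); rewrite -opprD -!mulrDl; congr (- (_ / _ / _)); lra.
Qed.

Lemma local_kernel_le (s u x : R) : 0 <= s -> s <= u -> 0 < x ->
  local_kernel p u 1 x <= local_kernel p s 1 x.
Proof.
move=> s0 su x0; rewrite (local_kernel_expR s) ler_piMl//.
  exact: (@weight_ge0 _ (local_weight p s 1)).
rewrite -[leRHS]expR0 ler_expR oppr_le0 !divr_ge0 ?sqr_ge0// subr_ge0.
by rewrite ler_sqr ?nnegrE// (le_trans s0).
Qed.

Lemma local_law_tail_le (a b1 t1 b2 t2 : R) : 0 < a ->
  b1 != 0 -> 0 < t1 -> b2 != 0 -> 0 < t2 -> `|b1 / t1| <= `|b2 / t2| ->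
  (local_law p b1 t1 `[a, +oo[%classic <= local_law p b2 t2 `[a, +oo[%classic)%E.
Proof.
move=> a0 b10 t10 b20 t20; set s := `|b1 / t1|; set u := `|b2 / t2| => su.
have c0 : 0 <= (u ^+ 2 - s ^+ 2) / 2.
  by rewrite divr_ge0// subr_ge0 ler_sqr ?nnegrE// /s /u.
(* The threshold is the exponential factor of [local_kernel_expR] at [x = a]; that factor is
   nondecreasing in [x], so it is at least the threshold on the tail and at most the threshold below
   [a]. *)
apply: (law_propto_le_ratio _ _ (expR (- ((u ^+ 2 - s ^+ 2) / 2 / a ^+ 2)))).
- exact: measurable_itv.
- exact: expR_gt0.
- exact: local_weight_mass.
- exact: local_weight_mass.
- move=> x /=; rewrite in_itv/= andbT => ax x0.
  rewrite [leRHS]local_kernel_ratio (local_kernel_ratio b1) -/s -/u.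
  rewrite (local_kernel_expR s u) ler_wpM2r//.
    exact: (@weight_ge0 _ (local_weight p s 1)).
  rewrite ler_expR lerN2 ler_wpM2l// lef_pV2 ?posrE ?exprn_gt0//.
  by rewrite ler_sqr// nnegrE ltW.
- move=> x /=; rewrite in_itv/= andbT => /negP; rewrite -ltNge => xa x0.
  rewrite [leLHS]local_kernel_ratio (local_kernel_ratio b1) -/s -/u.
  rewrite (local_kernel_expR s u) ler_wpM2r//.
    exact: (@weight_ge0 _ (local_weight p s 1)).
  rewrite ler_expR lerN2 ler_wpM2l// lef_pV2 ?posrE ?exprn_gt0//.
  by rewrite ler_sqr ?nnegrE ltW.
Qed.

(** * Limit of the normalizing mass as the ratio tends to 0 *)

Lemma local_mass_le (s u : R) : 0 <= s -> s <= u ->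
  (local_mass u <= local_mass s)%E.
Proof.
move=> s0 su; rewrite -[leRHS]mul1e.
apply: le_weight_measure => // x _ x0; rewrite mul1r; exact: local_kernel_le.
Qed.

(** Monotone convergence is a statement about sequences, so the ratio first runs through
    [1 / (n + 1)], along which the kernels increase pointwise. *)
Lemma local_mass_cvg_harmonic : local_mass (@harmonic R n) @[n --> \oo] -->
  weight_measure (inv_weight p) setT.
Proof.
rewrite /local_mass /weight_measure setTI.
set D : set (measurableTypeR R) := `]0, +oo[%classic.
have mD : measurable D by exact: measurable_itv.
have D0 x : D x -> 0 < x by rewrite /D/= in_itv/= andbT.
pose g n (x : measurableTypeR R) := (local_weight p (@harmonic R n) 1 x)%:E.
have g_cvg x : D x -> g n x @[n --> \oo] --> (inv_weight p x)%:E.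
  move=> Dx; apply: cvg_EFin; first exact: nearW.
  rewrite (_ : fine \o _ = fun n => x^-1 *
      expR (- ((@harmonic R n) ^+ 2 / 2 / x ^+ 2)) * p x); last first.
    by apply/funext => n; rewrite /= local_kernelE divr1 real_normK.
  suff : x^-1 * expR (- ((@harmonic R n) ^+ 2 / 2 / x ^+ 2)) * p x @[n --> \oo]
      --> x^-1 * expR 0 * p x by rewrite expR0 mulr1.
  apply: cvgM; last exact: cvg_cst.
  apply: cvgM; first exact: cvg_cst.
  apply: continuous_cvg; first exact: continuous_expR.
  have -> : 0 = - (0 ^+ 2 / 2 / x ^+ 2) :> R by rewrite expr0n/= !mul0r oppr0.
  apply: cvgN; do 2 (apply: cvgM; last exact: cvg_cst).
  apply: cvgM; exact: cvg_harmonic.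
have mono : (\int[lebesgue_measure]_(x in D) g n x)%E @[n --> \oo] -->
    (\int[lebesgue_measure]_(x in D) limn (g ^~ x))%E.
  apply: cvg_monotone_convergence => //.
  - by move=> k; apply/measurable_EFinP; exact: measurable_weight.
  - by move=> k x /D0 x0; rewrite lee_fin weight_ge0.
  - move=> x /D0 x0 m k mk; rewrite lee_fin; apply: local_kernel_le => //.
      exact: harmonic_ge0.
    by rewrite /harmonic/= lef_pV2 ?posrE// ler_nat.
have limE : (\int[lebesgue_measure]_(x in D) limn (g ^~ x) =
    \int[lebesgue_measure]_(x in D) (inv_weight p x)%:E)%E.
  by apply: eq_integral => x /set_mem Dx; apply/cvg_lim => //; exact: g_cvg.
by rewrite limE in mono.
Qed.

(** Monotonicity of the mass guarantees a right limit at 0 in the extended reals; the harmonic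
    sequence identifies its value. *)
Lemma local_mass_cvg : local_mass s @[s --> 0^'+] -->
  weight_measure (inv_weight p) setT.
Proof.
have h : {in Interval (BRight 0) +oo%O &, nonincreasing_fun local_mass}.
  move=> s u; rewrite !in_itv/= !andbT => s0 u0.
  by apply: local_mass_le; exact: ltW.
have cvg_sup := @nonincreasing_at_right_cvge R local_mass 0 +oo%O isT h.
have hr : @harmonic R @ \oo --> 0^'+.
  move=> A A0; have : \forall n \near \oo, 0 < @harmonic R n -> A (harmonic n).
    exact: cvg_harmonic A0.
  by apply: filterS => n; apply; exact: harmonic_gt0.
have := cvg_comp _ _ hr cvg_sup.
move/cvg_unique => /(_ _ _ local_mass_cvg_harmonic) <- //.
Qed.

Lemma local_weight_mass_cvg :
  weight_measure (local_weight p bt.1 bt.2) setT @[bt --> @ratio_to0 R] -->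
  weight_measure (inv_weight p) setT.
Proof.
under eq_fun do rewrite weight_measure_ratio.
(* The ratio approaches 0 from the right only, because [bt.1 != 0] and [0 < bt.2] make it
   positive. *)
have h : `|bt.1 / bt.2| @[bt --> @ratio_to0 R] --> (0 : R)^'+.
  move=> A /nbhs_ballP[e e0 Ae]; exists e => // bt [b0 t0 bte].
  have bt0 : 0 < `|bt.1 / bt.2|.
    by rewrite normr_gt0 mulf_neq0// invr_neq0// gt_eqF.
  by apply: Ae => //=; rewrite /ball/= sub0r normrN normr_id.
exact: cvg_comp h local_mass_cvg.
Qed.

(** * The two limit regimes *)

Lemma near_ratio_to0 : \forall bt \near @ratio_to0 R, bt.1 != 0 /\ 0 < bt.2.
Proof. by exists 1 => //= bt [b0 t0 _]. Qed.

(** On the tail [x^-1 <= a^-1] and the exponential is at most 1, so the unnormalized tail is at most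
    [a^-1] times the total mass 1 of the prior. *)
Lemma local_law_tail_mass (a b t : R) : 0 < a -> b != 0 -> 0 < t ->
  (local_law p b t `[a, +oo[%classic <=
   a^-1%:E * (fine (weight_measure (local_weight p b t) setT))^-1%:E)%E.
Proof.
move=> a0 b0 t0; have m0 := @local_weight_mass R p b t b0 t0.
rewrite [leLHS]law_proptoE// lee_wpmul2r//.
  by rewrite lee_fin invr_ge0 fine_ge0// measure_ge0.
(* The prior density itself, viewed as a weight. *)
pose pw := PosWeight (measurable_pdf p) (@pdf_ge0 R p).
have mA : measurable (`[a, +oo[%classic : set (measurableTypeR R)).
  exact: measurable_itv.
apply: (@le_trans _ _ (a^-1%:E * weight_measure pw `[a, +oo[%classic)%E).
  apply: le_weight_measure => //; first by rewrite invr_ge0 ltW.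
  move=> x /=; rewrite in_itv/= andbT => ax x0.
  rewrite local_kernelE ler_wpM2r ?pdf_ge0//.
  rewrite -[leRHS]mulr1 ler_pM ?expR_ge0 ?invr_ge0 ?(ltW x0)//.
    by rewrite lef_pV2 ?posrE.
  rewrite -[leRHS]expR0 ler_expR oppr_le0.
  by rewrite !divr_ge0 ?sqr_ge0.
have pw1 : weight_measure pw setT = 1%E.
  by rewrite /weight_measure setTI; exact: integral_pdf.
rewrite -[leRHS]mule1 lee_wpmul2l ?lee_fin ?invr_ge0 ?(ltW a0)//.
by rewrite -pw1; apply: le_measure; rewrite ?inE.
Qed.

Lemma local_law_tail_cvg0 (a : R) :
  weight_measure (inv_weight p) setT = +oo%E -> 0 < a ->
  local_law p bt.1 bt.2 `[a, +oo[%classic @[bt --> @ratio_to0 R] --> 0%E.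
Proof.
move=> moo a0; have := local_weight_mass_cvg; rewrite moo => /cvgeyPge Moo.
apply: cvg_EFin.
  by near=> bt; rewrite fin_num_measure//; exact: measurable_itv.
apply/cvgrPdist_le => e e0.
(* Once the mass [M] reaches [(a * e)^-1], the tail bound [1 / (a * M)] is at most [e]. *)
have := Moo (a * e)^-1; apply: filterS2 near_ratio_to0 => -[b t]/= [b0 t0] Mbt.
rewrite sub0r normrN ger0_norm ?fine_ge0 ?measure_ge0//.
have /andP[m0 m1] := @local_weight_mass R p b t b0 t0.
have mf : weight_measure (local_weight p b t) setT \is a fin_num.
  by rewrite ge0_fin_numE// ltW.
have ae0 : 0 < a * e by rewrite mulr_gt0.
have := @local_law_tail_mass a b t a0 b0 t0.
move: mf m0 Mbt; case: (weight_measure _ _) => // M _ /=.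
rewrite lte_fin lee_fin => M0 Mbt tail.
rewrite -lee_fin fineK; last first.
  by rewrite fin_num_measure//; exact: measurable_itv.
apply: (le_trans tail); rewrite -EFinM lee_fin -invfM.
rewrite -[leRHS]invrK lef_pV2 ?posrE ?invr_gt0 ?mulr_gt0//.
by move: Mbt; rewrite invfM -ler_pdivlMl ?invr_gt0// invrK mulrC.
Unshelve. all: by end_near. Qed.

Lemma local_law_cvg_dirac : weight_measure (inv_weight p) setT = +oo%E ->
  cvg_in_distribution (@ratio_to0 R) (fun bt => local_law p bt.1 bt.2)
    (dirac (0 : measurableTypeR R)).
Proof.
move=> moo; apply: cvg_in_distribution_dirac => a a0.
have := local_law_tail_cvg0 a moo a0; apply: cvg_trans.
apply: near_eq_cvg; apply: filterS near_ratio_to0 => -[b t]/= [b0 t0].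
(* The two events differ only on negative reals, to which the law gives no mass. *)
rewrite !local_lawE//; congr (_ * _)%E; congr (integral _ _ _).
by apply/seteqP; split => x /=; rewrite !in_itv/= !andbT subr0 => -[+ x0];
  rewrite gtr0_norm.
Qed.

(** Each kernel lies below the limit weight, its exponential being at most 1. Normalizing turns this
    into a domination of laws by the quotient of masses, which tends to 1 because the limit mass is
    finite and positive. *)
Lemma local_law_cvg_inv_weight : (weight_measure (inv_weight p) setT < +oo)%E ->
  cvg_in_distribution (@ratio_to0 R) (fun bt => local_law p bt.1 bt.2)
    (law_propto (inv_weight p)).
Proof.
move=> moo; pose M bt := weight_measure (local_weight p bt.1 bt.2) setT.
have lw (b t : R) A : measurable A ->
    (weight_measure (local_weight p b t) A <= weight_measure (inv_weight p) A)%E.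
  move=> mA; rewrite -[leRHS]mul1e; apply: le_weight_measure => // x _ x0.
  rewrite mul1r /= local_kernelE ler_wpM2r ?pdf_ge0//.
  rewrite -[leRHS]mulr1 ler_wpM2l//; first by rewrite invr_ge0 ltW.
  by rewrite -[leRHS]expR0 ler_expR oppr_le0 !divr_ge0 ?sqr_ge0.
(* Any admissible pair would do: the kernel at [(1, 1)] has positive mass and lies below the limit
   weight. *)
have m0 : (0 < weight_measure (inv_weight p) setT)%E.
  have /andP[+ _] := @local_weight_mass R p 1 1 (oner_neq0 _) ltr01.
  by move=> /lt_le_trans; apply; exact: lw.
set m := fine (weight_measure (inv_weight p) setT).
have mfin : weight_measure (inv_weight p) setT \is a fin_num.
  by rewrite ge0_fin_numE// ltW.
have fm0 : 0 < m by rewrite fine_gt0// m0.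
apply: (cvg_in_distribution_dominated _ (fun bt => m / fine (M bt))).
  rewrite -[X in _ --> X](@divff _ m); last by rewrite gt_eqF.
  apply: cvgM; first exact: cvg_cst.
  apply: cvgV; first by rewrite gt_eqF.
  by apply: fine_cvg; rewrite fineK//; exact: local_weight_mass_cvg.
apply: filterS near_ratio_to0 => -[b t]/= [b0 t0] A mA.
rewrite [X in (X <= _)%E]law_proptoE; last exact: local_weight_mass.
(* The factor [m] cancels the normalization of the limit law, leaving two unnormalized measures
   divided by the same mass. *)
rewrite law_proptoE ?m0// [leRHS]muleC -muleA -EFinM mulKf ?gt_eqF//.
rewrite lee_wpmul2r//; last exact: lw.
by rewrite lee_fin invr_ge0 fine_ge0// measure_ge0.
Qed.

End local_law_theory.

Theorem proposition3p3 (R : realType) (pi_loc : pos_pdf R) :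
  (forall a : R, 0 < a ->
    forall beta1 tau1 beta2 tau2 : R,
      beta1 != 0 -> 0 < tau1 -> beta2 != 0 -> 0 < tau2 ->
      `|beta1 / tau1| <= `|beta2 / tau2| ->
      (local_law pi_loc beta1 tau1 `[a, +oo[%classic
         <= local_law pi_loc beta2 tau2 `[a, +oo[%classic)%E)
  /\ ((\int[lebesgue_measure]_(x in `]0%R, +oo[) (x^-1 * pi_loc x)%:E = +oo)%E ->
      (forall a : R, 0 < a ->
         local_law pi_loc bt.1 bt.2 `[a, +oo[%classic @[bt --> @ratio_to0 R] --> 0%E)
      /\ cvg_in_distribution (@ratio_to0 R)
           (fun bt => local_law pi_loc bt.1 bt.2)
           (dirac (0 : measurableTypeR R)))
  /\ ((\int[lebesgue_measure]_(x in `]0%R, +oo[) (x^-1 * pi_loc x)%:E < +oo)%E ->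
      cvg_in_distribution (@ratio_to0 R)
        (fun bt => local_law pi_loc bt.1 bt.2)
        (law_propto (inv_weight pi_loc))).
Proof.
have M0 : weight_measure (inv_weight pi_loc) setT =
    (\int[lebesgue_measure]_(x in `]0%R, +oo[) (x^-1 * pi_loc x)%:E)%E.
  by rewrite /weight_measure setTI.
split; first by move=> a a0 b1 t1 b2 t2; exact: local_law_tail_le.
split; rewrite -M0 => Moo; last exact: local_law_cvg_inv_weight.
split; last exact: local_law_cvg_dirac.
by move=> a; exact: local_law_tail_cvg0.
Qed.
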